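(* Let $\mathfrak{c}\subseteq\mathrm{Cu}$ be a Fraïssé category. Then $\mathfrak{c}$ admits a Fraïssé sequence, and it is unique up to two-sided approximate intertwining in $\mathfrak{c}$; that is, for any two Fraïssé sequences $(S_i,\sigma_{i,j})_i$ and $(T_i,\tau_{i,j})_i$ in $\mathfrak{c}$ there exists a two-sided approximate intertwining $(\alpha_i\colon S_i\to T_{\varphi(i)},\ \beta_i\colon T_i\to S_{\psi(i)})_i$ consisting of $\mathfrak{c}$-morphisms.
   Context: **$\mathrm{Cu}$-semigroups.** For $x,y$ in a partially ordered set, $x\ll y$ means: for every increasing sequence $(z_n)_n$ having a supremum with $y\le\sup_n z_n$, there is $n$ with $x\le z_n$. A $\mathrm{Cu}$-semigroup is a positively ordered (commutative) monoid $S$ such that (O1) every increasing sequence has a supremum; (O2) every element is the supremum of a $\ll$-increasing sequence; (O3) $x'\ll x$ and $y'\ll y$ imply $x'+y'\ll x+y$; (O4) $\sup_n(x_n+y_n)=\sup_n x_n+\sup_n y_n$ for increasing sequences. A $\mathrm{Cu}$-morphism is a monoid morphism preserving the order, the relation $\ll$, and suprema of increasing sequences. $\mathrm{Cu}$ denotes the resulting category. $S$ is countably-based if there is a countable subset $B\subseteq S$ such that every element of $S$ is the supremum of a $\ll$-increasing sequence in $B$. **Finite-set comparison.** For $\mathrm{Cu}$-morphisms $\alpha,\beta\colon S\to T$ and a finite set $F\subseteq S$, write $\alpha\simeq_F\beta$ if $\alpha(x')\le\beta(x)$ and $\beta(x')\le\alpha(x)$ for all $x',x\in F$ with $x'\ll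 x$. **Fraïssé categories.** A subcategory $\mathfrak{c}$ of $\mathrm{Cu}$ is a (Cuntz) Fraïssé category if: - (JEP) for any $A_1,A_2\in\mathfrak{c}$ there is $B\in\mathfrak{c}$ with $\mathrm{Hom}_{\mathfrak{c}}(A_1,B)$ and $\mathrm{Hom}_{\mathfrak{c}}(A_2,B)$ nonempty; - (NAP) for any $\mathfrak{c}$-morphisms $\alpha_1\colon A\to B_1$, $\alpha_2\colon A\to B_2$ and any finite $F\subseteq A$, there are $C\in\mathfrak{c}$ and $\mathfrak{c}$-morphisms $\beta_1\colon B_1\to C$, $\beta_2\colon B_2\to C$ with $\beta_1\circ\alpha_1\simeq_F\beta_2\circ\alpha_2$; - (SEP) there is a subcategory $\mathfrak{s}\subseteq\mathfrak{c}$ whose objects are countably-based, whose set of morphisms is countable, such that every $A\in\mathfrak{c}$ admits a $\mathfrak{c}$-morphism to some $S\in\mathfrak{s}$, and such that for any $\mathfrak{c}$-morphism $\sigma\colon S\to A$ with $S\in\mathfrak{s}$ and any finite $F\subseteq S$ there are $T\in\mathfrak{s}$, $\alpha\in\mathrm{Hom}_{\mathfrak{c}}(A,T)$, $\tau\in\mathrm{Hom}_{\mathfrak{s}}(S,T)$ with $\alpha\circ\sigma\simeq_F\tau$. **Fraïssé sequences.** An inductive sequence $(S_i,\sigma_{i,j})_{i\in\mathbb{N}}$ in $\mathfrak{c}$ is a Fraïssé sequence if every $S_i$ is countably-based and, for every $i$, every finite $F\subseteq S_i$ and every $\mathfrak{c}$-morphism $\alpha\colon S_i\to C$, there are $j\ge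 i$ and a $\mathfrak{c}$-morphism $\beta_F\colon C\to S_j$ with $\beta_F\circ\alpha\simeq_F\sigma_{i,j}$. **Two-sided approximate intertwinings.** Let $\varphi,\psi\colon\mathbb{N}\to\mathbb{N}$ be strictly increasing and let $\alpha_i\colon S_i\to T_{\varphi(i)}$, $\beta_i\colon T_i\to S_{\psi(i)}$ be morphisms. $(\alpha_i,\beta_i)_i$ is a two-sided approximate intertwining if for any $i$ and any finite sets $F\subseteq S_i$, $G\subseteq T_i$ there are $i_F,i_G\ge i$ such that for all $j\ge i_F$, $j'\ge i_G$, $k\ge\varphi(j)$, $k'\ge\psi(j')$, $$\sigma_{i,\psi(k)}\simeq_F\beta_k\circ\tau_{\varphi(j),k}\circ\alpha_j\circ\sigma_{i,j}\quad\text{and}\quad\tau_{i,\varphi(k')}\simeq_G\alpha_{k'}\circ\sigma_{\psi(j'),k'}\circ\beta_{j'}\circ\tau_{i,j'}.$$ *)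

(* Defs.v *)
From HB Require Import structures.
From mathcomp Require Import all_boot all_order.
From mathcomp Require Import boolp classical_sets functions cardinality.

Set Implicit Arguments.
Unset Strict Implicit.
Unset Printing Implicit Defensive.

Import Order.TTheory.
Local Open Scope classical_set_scope.
Local Open Scope order_scope.

Declare Scope cu_scope.
Delimit Scope cu_scope with Cu.
Local Open Scope cu_scope.

Reserved Notation "x `<< y" (at level 70, no associativity).

Definition increasing_seq (d : Order.disp_t) (T : porderType d)
    (u : nat -> T) : Prop :=
  {homo u : m n / (m <= n)%N >-> m <= n}.

Definition is_sup_seq (d : Order.disp_t) (T : porderType d)
    (u : nat -> T) (s : T) : Prop :=
  isLub (range u) s.

Definition way_below (d : Order.disp_t) (T : porderType d) (x y : T) : Prop :=
  forall (z : nat -> T) (s : T),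
    increasing_seq z -> is_sup_seq z s -> y <= s -> exists n, x <= z n.

Notation "x `<< y" := (way_below x y) : cu_scope.

Definition way_below_increasing (d : Order.disp_t) (T : porderType d)
    (u : nat -> T) : Prop :=
  forall n, u n `<< u n.+1.

Fact cu_display : Order.disp_t. Proof. exact: Order.Disp tt tt. Qed.

(* The monoid structure is not taken from GRing.Nmodule: the only join of
   Order.POrder with it in the library is porderZmodType, which is a group. *)
HB.mixin Record isPosOrderedMonoid T of Order.POrder cu_display T := {
  pom_zero : T ;
  pom_add : T -> T -> T ;
  pom_addA : associative pom_add ;
  pom_addC : commutative pom_add ;
  pom_add0 : left_id pom_zero pom_add ;
  pom_ge0 : forall x : T, pom_zero <= x ;
  pom_leD : forall x x' y y' : T,
    x <= x' -> y <= y' -> pom_add x y <= pom_add x' y'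
}.

#[short(type="posOrderedMonoidType")]
HB.structure Definition PosOrderedMonoid :=
  { T of Order.POrder cu_display T & isPosOrderedMonoid T }.

Notation "0" := pom_zero : cu_scope.
Notation "x + y" := (pom_add x y) : cu_scope.

HB.mixin Record isCuSemigroup T of PosOrderedMonoid T := {
  cu_O1 : forall u : nat -> T, increasing_seq u -> exists s, is_sup_seq u s ;
  cu_O2 : forall x : T,
    exists u : nat -> T, way_below_increasing u /\ is_sup_seq u x ;
  cu_O3 : forall x' x y' y : T,
    x' `<< x -> y' `<< y -> x' + y' `<< x + y ;
  cu_O4 : forall (u v : nat -> T) (s t : T),
    increasing_seq u -> increasing_seq v ->
    is_sup_seq u s -> is_sup_seq v t ->
    is_sup_seq (fun n => u n + v n) (s + t)
}.

#[short(type="cuSemigroupType")]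
HB.structure Definition CuSemigroup :=
  { T of PosOrderedMonoid T & isCuSemigroup T }.

Definition cu_morphism (S T : cuSemigroupType) (f : S -> T) : Prop :=
  [/\ f 0 = 0 /\ {morph f : x y / x + y},
      {homo f : x y / x <= y},
      {homo f : x y / x `<< y}
    & forall (u : nat -> S) (s : S),
        increasing_seq u -> is_sup_seq u s -> is_sup_seq (f \o u) (f s)].

Definition countably_based (S : cuSemigroupType) : Prop :=
  exists B : set S, countable B /\
    forall x : S, exists u : nat -> S,
      [/\ forall n, B (u n), way_below_increasing u & is_sup_seq u x].

Definition sim_on (S T : cuSemigroupType) (F : set S) (f g : S -> T) : Prop :=
  forall x' x, F x' -> F x -> x' `<< x -> f x' <= g x /\ g x' <= f x.

(* A not necessarily full subcategory of Cu; its morphisms are given as the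
   underlying maps between carriers. *)
Record subcategory : Type := Subcategory {
  obj : cuSemigroupType -> Prop ;
  mor : forall S T : cuSemigroupType, (S -> T) -> Prop ;
  mor_cu : forall (S T : cuSemigroupType) (f : S -> T),
    mor f -> [/\ obj S, obj T & cu_morphism f] ;
  mor_id : forall S : cuSemigroupType, obj S -> mor (@id S) ;
  mor_comp : forall (S T U : cuSemigroupType) (f : S -> T) (g : T -> U),
    mor f -> mor g -> mor (g \o f)
}.

Definition subcategory_le (s c : subcategory) : Prop :=
  (forall S : cuSemigroupType, obj s S -> obj c S) /\
  (forall (S T : cuSemigroupType) (f : S -> T), mor s f -> mor c f).

Definition morphisms (c : subcategory) :
    set {S : cuSemigroupType & {T : cuSemigroupType & S -> T}} :=
  [set a | mor c (projT2 (projT2 a))].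

Definition JEP (c : subcategory) : Prop :=
  forall A1 A2 : cuSemigroupType, obj c A1 -> obj c A2 ->
  exists (B : cuSemigroupType) (f1 : A1 -> B) (f2 : A2 -> B),
    [/\ obj c B, mor c f1 & mor c f2].

Definition NAP (c : subcategory) : Prop :=
  forall (A B1 B2 : cuSemigroupType) (a1 : A -> B1) (a2 : A -> B2) (F : set A),
  mor c a1 -> mor c a2 -> finite_set F ->
  exists (C : cuSemigroupType) (b1 : B1 -> C) (b2 : B2 -> C),
    [/\ obj c C, mor c b1, mor c b2 & sim_on F (b1 \o a1) (b2 \o a2)].

Definition SEP (c : subcategory) : Prop :=
  exists s : subcategory,
  [/\ subcategory_le s c,
      forall S : cuSemigroupType, obj s S -> countably_based S,
      countable (morphisms s),
      forall A : cuSemigroupType, obj c A ->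
        exists (S : cuSemigroupType) (f : A -> S), obj s S /\ mor c f
    & forall (S A : cuSemigroupType) (sigma : S -> A) (F : set S),
        obj s S -> mor c sigma -> finite_set F ->
        exists (T : cuSemigroupType) (alpha : A -> T) (tau : S -> T),
          [/\ obj s T, mor c alpha, mor s tau
            & sim_on F (alpha \o sigma) tau]].

Definition fraisse_category (c : subcategory) : Prop :=
  [/\ JEP c, NAP c & SEP c].

Record ind_seq (c : subcategory) : Type := IndSeq {
  term :> nat -> cuSemigroupType ;
  bond : forall i j : nat, (i <= j)%N -> term i -> term j ;
  bond_mor : forall (i j : nat) (ij : (i <= j)%N), mor c (bond ij) ;
  bond_id : forall (i : nat) (ii : (i <= i)%N), bond ii =1 id ;
  bond_comp : forall (i j k : nat)
      (ij : (i <= j)%N) (jk : (j <= k)%N) (ik : (i <= k)%N),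
    bond jk \o bond ij =1 bond ik
}.
Arguments bond {c} _ {i j} _.

Definition fraisse_seq (c : subcategory) (S : ind_seq c) : Prop :=
  (forall i, countably_based (S i)) /\
  (forall (i : nat) (F : set (S i)) (C : cuSemigroupType) (alpha : S i -> C),
     finite_set F -> mor c alpha ->
     exists (j : nat) (ij : (i <= j)%N) (beta : C -> S j),
       mor c beta /\ sim_on F (beta \o alpha) (bond S ij)).

(* The inequalities i <= psi k and i <= phi k' that index the bonding maps on
   the left-hand sides always hold since phi and psi are strictly increasing;
   by boolean proof irrelevance the choice of their proofs is immaterial. *)
Definition two_sided_approx_intertwining (c : subcategory) (S T : ind_seq c)
    (phi psi : nat -> nat)
    (alpha : forall i, S i -> T (phi i))
    (beta : forall i, T i -> S (psi i)) : Prop :=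
  [/\ {homo phi : m n / (m < n)%N},
      {homo psi : m n / (m < n)%N}
    & forall (i : nat) (F : set (S i)) (G : set (T i)),
      finite_set F -> finite_set G ->
      exists iF iG : nat, [/\ (i <= iF)%N, (i <= iG)%N &
        forall j j' k k' : nat, (iF <= j)%N -> (iG <= j')%N ->
        forall (ij : (i <= j)%N) (ij' : (i <= j')%N)
               (jk : (phi j <= k)%N) (jk' : (psi j' <= k')%N)
               (ik : (i <= psi k)%N) (ik' : (i <= phi k')%N),
          sim_on F (bond S ik)
            (beta k \o bond T jk \o alpha j \o bond S ij) /\
          sim_on G (bond T ik')
            (alpha k' \o bond S jk' \o beta j' \o bond T ij')]].

(* Main.v *)
Require Import Defs.
From mathcomp Require Import all_boot all_order.
From mathcomp Require Import boolp classical_sets functions cardinality.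

Set Implicit Arguments.
Unset Strict Implicit.
Unset Printing Implicit Defensive.

Import Order.TTheory.
Local Open Scope classical_set_scope.
Local Open Scope order_scope.

(** The relation [sim_on F] is transitive up to enlarging [F] by interpolating
    elements, which plays the role of the triangle inequality.

    Uniqueness: going back and forth between two Fraisse sequences gives maps
    f_n : S_(a n) -> T_(b n) and g_n : T_(b n) -> S_(a (n+1)) whose composites
    are close to the bonding maps on finite sets that exhaust countable bases.
    Since the interpolants of one stage belong to the finite set of the next,
    f_k o sigma and tau o f_j stay comparable for all k >= j, and
    f_i o sigma_(i, a i), g_i o tau_(i, b i) form an intertwining.

    Existence: in the countable subcategory s, enumerate the pairs (object S_i
    already built, morphism f : S_i -> T).  At each stage, amalgamate f with
    the bonding map S_i -> S_n and return to s by (SEP); this absorbs f. *)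

(** * The way-below relation and countable bases *)

Lemma way_below_le (d : Order.disp_t) (T : porderType d) (x y : T) :
  (x `<< y)%Cu -> x <= y.
Proof.
move=> xy; have [| |//|n //] := xy (fun=> y) y.
- by move=> m n _ /=.
- split; first by move=> _ [n _ <-].
  by move=> z zub; apply: zub; exists 0%N.
Qed.

Lemma le_way_below_trans (d : Order.disp_t) (T : porderType d) (x y z : T) :
  x <= y -> (y `<< z)%Cu -> (x `<< z)%Cu.
Proof.
move=> xy yz u s ui us zs; have [n yu] := yz u s ui us zs.
by exists n; apply: le_trans yu.
Qed.

Lemma way_below_le_trans (d : Order.disp_t) (T : porderType d) (x y z : T) :
  (x `<< y)%Cu -> y <= z -> (x `<< z)%Cu.
Proof. by move=> xy yz u s ui us zs; apply: xy us (le_trans yz zs). Qed.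

(** Some [u n] dominates [x']; the next term [u n.+1] lies strictly between, as [u n] is way below
    it and it is way below [u n.+2]. *)
Lemma way_below_interpolation (d : Order.disp_t) (T : porderType d)
    (u : nat -> T) (x' x : T) :
  way_below_increasing u -> is_sup_seq u x -> (x' `<< x)%Cu ->
  exists n, (x' `<< u n)%Cu /\ (u n `<< x)%Cu.
Proof.
move=> ub ux xx.
have ui : increasing_seq u.
  by apply: homo_leq => [//|y x0 z|n]; [apply: le_trans|apply: way_below_le].
have [n xn] := xx u x ui ux (lexx x).
exists n.+1; split; first exact: le_way_below_trans xn (ub n).
by apply: way_below_le_trans (ub n.+1) _; apply: ux.1; exists n.+2.
Qed.

(** The form in which a countable base is used: interpolation by a single sequence, whose initial
    segments serve as test sets. *)
Definition way_below_dense (S : cuSemigroupType) (e : nat -> S) : Prop :=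
  forall x' x, (x' `<< x)%Cu -> exists p, (x' `<< e p)%Cu /\ (e p `<< x)%Cu.

Lemma countably_based_dense (S : cuSemigroupType) :
  countably_based S -> exists e : nat -> S, way_below_dense e.
Proof.
move=> [B [cB hB]].
have B0 : B !=set0 by have [u [Bu _ _]] := hB pom_zero; exists (u 0%N).
have /pfcard_geP[B0'|[g]] := cB; first by move: B0; rewrite B0' => -[].
exists g => x' x xx; have [u [Bu ub ux]] := hB x.
have [n [h1 h2]] := way_below_interpolation ub ux xx.
have [p _ gp] := @surj _ _ _ _ g _ (Bu n).
by exists p; rewrite gp.
Qed.

(* The relation [sim_on F] is not transitive; a set [E] refining [F] provides
   the intermediate points needed to chain two comparisons on [E] into one
   on [F]. *)
Definition refines (d : Order.disp_t) (T : porderType d) (F E : set T) : Prop :=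
  forall x' x, F x' -> F x -> (x' `<< x)%Cu -> exists y1 y2 y3,
    [/\ E y1, E y2, E y3 & [/\ x' <= y1, (y1 `<< y2)%Cu, (y2 `<< y3)%Cu &
      y3 <= x]].

Lemma finite_set_bound (T : choiceType) (F : set T) (P : T -> nat -> Prop) :
  finite_set F ->
  (forall x n m, (n <= m)%N -> P x n -> P x m) ->
  (forall x, F x -> exists n, P x n) ->
  exists N, forall x, F x -> P x N.
Proof.
move=> /finite_seqP[s ->] Pmono {F}.
elim: s => [|a s IH] sP; first by exists 0%N.
have [|N hN] := IH; first by move=> x xs; apply: sP; rewrite /= inE xs orbT.
have [|n hn] := sP a; first by rewrite /= inE eqxx.
exists (maxn n N) => x; rewrite /= inE => /orP[/eqP->|xs].
  by apply: Pmono hn; apply: leq_maxl.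
by apply: Pmono (hN x xs); apply: leq_maxr.
Qed.

(** Three interpolations give the witnesses for one pair, and finiteness of [F] bounds their
    indices. Initial segments of one fixed sequence thus refine any finite set, even one prescribed
    after a construction is over. *)
Lemma refines_dense (S : cuSemigroupType) (e : nat -> S) (F : set S) :
  way_below_dense e -> finite_set F ->
  exists N, refines F (e @` `I_N).
Proof.
move=> ed fF.
pose P (z : S * S) N := (z.1 `<< z.2)%Cu -> exists y1 y2 y3,
  [/\ (e @` `I_N) y1, (e @` `I_N) y2, (e @` `I_N) y3 &
    [/\ z.1 <= y1, (y1 `<< y2)%Cu, (y2 `<< y3)%Cu & y3 <= z.2]].
have [|z n m nm hz zz|[x' x] _|N hN] := @finite_set_bound _ (F `*` F) P.
- exact: finite_setX.
- have sub y : (e @` `I_n) y -> (e @` `I_m) y.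
    by move=> [p pn <-]; exists p => //; apply: leq_trans pn nm.
  have [y1 [y2 [y3 [h1 h2 h3 h]]]] := hz zz.
  by exists y1, y2, y3; split => //; apply: sub.
- have [xx|nxx] := pselect (x' `<< x)%Cu; last by exists 0%N => /nxx.
  have [p2 [xp2 p2x]] := ed _ _ xx.
  have [p1 [xp1 p12]] := ed _ _ xp2.
  have [p3 [p23 p3x]] := ed _ _ p2x.
  exists (maxn p1 (maxn p2 p3)).+1 => _.
  exists (e p1), (e p2), (e p3); split.
  + by exists p1 => //=; rewrite ltnS leq_max leqnn.
  + by exists p2 => //=; rewrite ltnS !leq_max leqnn orbT.
  + by exists p3 => //=; rewrite ltnS !leq_max leqnn !orbT.
  + by split => //; apply: way_below_le.
- by exists N => x' x Fx' Fx; apply: (hN (x', x)).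
Qed.

Lemma refines_exists (S : cuSemigroupType) (F : set S) :
  finite_set F -> exists E, [/\ finite_set E, F `<=` E & refines F E].
Proof.
move=> fF.
have /choice[m hm] : forall z : S * S, exists y,
    (z.1 `<< z.2)%Cu -> (z.1 `<< y)%Cu /\ (y `<< z.2)%Cu.
  move=> [x' x]; have [xx|nxx] := pselect (x' `<< x)%Cu; last by exists x.
  have [u [ub ux]] := cu_O2 x.
  by have [n hn] := way_below_interpolation ub ux xx; exists (u n).
pose l z := m (z.1, m z); pose r z := m (m z, z.2).
exists (F `|` (m @` (F `*` F) `|` (l @` (F `*` F) `|` r @` (F `*` F)))); split.
- have fFF : finite_set (F `*` F) by exact: finite_setX.
  by rewrite !finite_setU; do !split=> //; apply: finite_image.
- by move=> x Fx; left.
- move=> x' x Fx' Fx xx; have [xm mx] := hm (x', x) xx.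
  have [xl lm] := hm (x', m (x', x)) xm.
  have [mr rx] := hm (m (x', x), x) mx.
  exists (l (x', x)), (m (x', x)), (r (x', x)); split.
  + by right; right; left; exists (x', x).
  + by right; left; exists (x', x).
  + by right; right; right; exists (x', x).
  + by split => //; apply: way_below_le.
Qed.

(** * Calculus of finite-set comparison *)

Section SimOn.
Variables S T U : cuSemigroupType.
Implicit Types (f g h : S -> T) (E F : set S).

Lemma sim_on_sym F f g : sim_on F f g -> sim_on F g f.
Proof. by move=> fg x' x Fx' Fx xx; have [] := fg x' x Fx' Fx xx. Qed.

Lemma sim_on_sub E F f g : E `<=` F -> sim_on F f g -> sim_on E f g.
Proof. by move=> EF fg x' x /EF Fx' /EF Fx; apply: fg. Qed.

Lemma sim_on_ext F f f' g g' : f =1 f' -> g =1 g' -> sim_on F f g ->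
  sim_on F f' g'.
Proof. by move=> /funext<- /funext<-. Qed.

(** The chain is [f x' <= f y1 <= g y2 <= h y3 <= h x], and the same with [f] and [h] exchanged. *)
Lemma sim_on_trans E F f g h :
  cu_morphism f -> cu_morphism h -> refines F E ->
  sim_on E f g -> sim_on E g h -> sim_on F f h.
Proof.
move=> [_ fh _ _] [_ hh _ _] FE fg gh x' x Fx' Fx xx.
have [y1 [y2 [y3 [E1 E2 E3 [x1 w12 w23 x3]]]]] := FE _ _ Fx' Fx xx.
have [fg12 _] := fg _ _ E1 E2 w12; have [_ fg23] := fg _ _ E2 E3 w23.
have [_ gh12] := gh _ _ E1 E2 w12; have [gh23 _] := gh _ _ E2 E3 w23.
split.
  by apply: le_trans (fh _ _ x1) (le_trans fg12 (le_trans gh23 (hh _ _ x3))).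
by apply: le_trans (hh _ _ x1) (le_trans gh12 (le_trans fg23 (fh _ _ x3))).
Qed.

Lemma sim_on_comp_l F f g (h : T -> U) :
  cu_morphism h -> sim_on F f g -> sim_on F (h \o f) (h \o g).
Proof.
move=> [_ hh _ _] fg x' x Fx' Fx xx; have [h1 h2] := fg _ _ Fx' Fx xx.
by split; apply: hh.
Qed.

Lemma sim_on_comp_r F (E : set U) f g (h : U -> S) :
  cu_morphism h -> h @` E `<=` F -> sim_on F f g ->
  sim_on E (f \o h) (g \o h).
Proof.
move=> [_ _ hh _] EF fg x' x Ex' Ex xx.
by apply: fg; [apply: EF; exists x'|apply: EF; exists x|apply: hh].
Qed.

End SimOn.

Lemma dependent_nat_choice (T : Type) (P : nat -> T -> Prop)
    (R : nat -> T -> T -> Prop) (x0 : T) :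
  P 0%N x0 ->
  (forall n x, P n x -> exists y, P n.+1 y /\ R n x y) ->
  exists u : nat -> T, forall n, P n (u n) /\ R n (u n) (u n.+1).
Proof.
move=> P0 step.
have /choice[s hs] : forall z : nat * T, exists y,
    P z.1 z.2 -> P z.1.+1 y /\ R z.1 z.2 y.
  move=> [n x]; have [Px|nPx] := pselect (P n x); last by exists x.
  by have [y hy] := step n x Px; exists y.
pose u := fix u n := if n is m.+1 then s (m, u m) else x0.
have Pu n : P n (u n) by elim: n => [//|n /(hs (n, u n))[]].
by exists u => n; split => //; apply: (hs (n, u n) (Pu n)).2.
Qed.

Lemma cu_mor (c : subcategory) (S T : cuSemigroupType) (f : S -> T) :
  mor c f -> cu_morphism f.
Proof. by case/mor_cu. Qed.

(** * Uniqueness: the back-and-forth construction *)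

Section Uniqueness.
Variable c : subcategory.

Lemma bond_trans (S : ind_seq c) i j k (ij : (i <= j)%N) (jk : (j <= k)%N)
    (ik : (i <= k)%N) x : bond S jk (bond S ij x) = bond S ik x.
Proof. exact: (bond_comp ij jk ik x). Qed.

(** Finite stages that, as [n] and [a] grow, capture the images of every point of every base. *)
Definition bases_upto (S : ind_seq c) (e : forall i, nat -> S i) n a :
    set (S a) :=
  [set x | exists i p (ia : (i <= a)%N),
    [/\ (i <= n)%N, (p < n)%N & x = bond S ia (e i p)]].
Arguments bases_upto {S} e n a _.

Lemma finite_bases_upto (S : ind_seq c) (e : forall i, nat -> S i) n a :
  finite_set (bases_upto e n a).
Proof.
(* The proof of [i <= a] is replaced by a boolean test, so that the set lies in the image of a
   finite box; the value [0] is taken only when [z.1 > a]. *)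
pose b (z : nat * nat) : S a :=
  if boolP (z.1 <= a)%N is AltTrue ia then bond S ia (e z.1 z.2) else pom_zero.
apply: (@sub_finite_set _ _ (b @` (`I_n.+1 `*` `I_n))); last first.
  by apply: finite_image; apply: finite_setX.
move=> _ [i [p [ia [i_n p_n ->]]]]; exists (i, p) => //; rewrite /b /=.
case: {-}_ / boolP => [ia'|]; last by rewrite ia.
by rewrite (bool_irrelevance ia ia').
Qed.

Lemma bases_upto_absorb (S : ind_seq c) (e : forall i, nat -> S i) n a i N
    (ia : (i <= a)%N) :
  (i <= n)%N -> (N <= n)%N ->
  bond S ia @` (e i @` `I_N) `<=` bases_upto e n a.
Proof.
move=> i_n Nn _ [_ [p pN <-] <-]; exists i, p, ia; split => //.
exact: leq_trans pN Nn.
Qed.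

(** One further bonding map makes the index strictly larger; this is what makes [phi] and [psi]
    strictly increasing. *)
Lemma fraisse_seq_back (S : ind_seq c) i (F : set (S i)) (C : cuSemigroupType)
    (f : S i -> C) : fraisse_seq S -> finite_set F -> mor c f ->
  exists j (ij : (i < j)%N) (g : C -> S j),
    mor c g /\ sim_on F (g \o f) (bond S (ltnW ij)).
Proof.
move=> [_ hS] fF mf; have [j [ij [g [mg gf]]]] := hS i F C f fF mf.
have ij1 : (i < j.+1)%N by rewrite ltnS.
exists j.+1, ij1, (bond S (leqnSn j) \o g); split.
  by apply: mor_comp mg _; apply: bond_mor.
have mb := cu_mor (bond_mor S (leqnSn j)).
apply: sim_on_ext (sim_on_comp_l mb gf) => // x /=; exact: bond_trans.
Qed.

Variables S T : ind_seq c.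
Variables (eS : forall i, nat -> S i) (eT : forall i, nat -> T i).

Record zigzag := Zigzag {
  zidx : nat; zjdx : nat;
  zmap : S zidx -> T zjdx;
  zset : set (S zidx) }.
Arguments zmap z _ : clear implicits.
Arguments zset z _ : clear implicits.

Definition zigzag_ok n (z : zigzag) :=
  [/\ finite_set (zset z), mor c (zmap z) &
      bases_upto eS n (zidx z) `<=` zset z].

(** [zset w] receives the images of [E] and [G], so comparisons at stage [w] pull back along the
    bonding map and along [g]; [E] refines [zset z], which leaves room to chain them. *)
Definition zigzag_step n (z w : zigzag) :=
  exists (g : T (zjdx z) -> S (zidx w))
    (ii : (zidx z < zidx w)%N) (jj : (zjdx z < zjdx w)%N)
    (E : set (S (zidx z))) (G : set (T (zjdx z))),
  [/\ mor c g,
      [/\ refines (zset z) E, zset z `<=` E &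
          bond S (ltnW ii) @` E `<=` zset w],
      [/\ bases_upto eT n (zjdx z) `<=` G & g @` G `<=` zset w],
      sim_on E (g \o zmap z) (bond S (ltnW ii)) /\
      sim_on E (zmap w \o bond S (ltnW ii)) (bond T (ltnW jj) \o zmap z) &
      sim_on G (zmap w \o g) (bond T (ltnW jj))].

Hypotheses (hS : fraisse_seq S) (hT : fraisse_seq T).

(** Two layers of refinement are taken: the comparison of [f'] and [f] along bonding maps is
    obtained on [E] by chaining through [f' \o g \o f] on [E'], and [E] in turn refines [F] for
    later chaining. *)
Lemma zigzag_next n z : zigzag_ok n z ->
  exists w, zigzag_ok n.+1 w /\ zigzag_step n z w.
Proof.
case: z => a b f F [/= fF mf _].
have [E [fE FE rE]] := refines_exists fF.
have [E' [fE' EE' rE']] := refines_exists fE.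
have [a' [aa' [g [mg gf]]]] := fraisse_seq_back hS fE' mf.
pose G := f @` E' `|` bases_upto eT n b.
have fG : finite_set G.
  rewrite finite_setU; split; first exact: finite_image.
  exact: finite_bases_upto.
have [b' [bb' [f' [mf' fg]]]] := fraisse_seq_back hT fG mg.
pose F' := bond S (ltnW aa') @` E `|` (g @` G `|` bases_upto eS n.+1 a').
exists (@Zigzag a' b' f' F'); split.
  split => //=; last by move=> x hx; right; right.
  rewrite !finite_setU; split; first exact: finite_image.
  by split; [exact: finite_image|exact: finite_bases_upto].
exists g, aa', bb', E, G; split => //=.
- by split => // x hx; left.
- by split => x hx; [right|right; left].
- split; first exact: sim_on_sub gf.
  apply: (sim_on_trans _ _ rE' (g := f' \o (g \o f))).
  + by apply: cu_mor; apply: mor_comp mf'; apply: bond_mor.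
  + by apply: cu_mor; apply: mor_comp mf _; apply: bond_mor.
  + by apply: sim_on_sym; apply: sim_on_comp_l gf; apply: cu_mor mf'.
  + apply: sim_on_comp_r fg; first exact: cu_mor mf.
    by move=> y hy; left.
Qed.

Lemma zigzag_exists : JEP c ->
  exists u : nat -> zigzag,
    forall n, zigzag_ok n (u n) /\ zigzag_step n (u n) (u n.+1).
Proof.
move=> jep.
have [oS _ _] := mor_cu (bond_mor S (leqnn 0)).
have [oT _ _] := mor_cu (bond_mor T (leqnn 0)).
have [B [h1 [h2 [_ mh1 mh2]]]] := jep _ _ oS oT.
(* The empty set imposes no comparison: the aim is just a morphism from [B] back into the sequence
   [T]. *)
have [b [_ [h [mh _]]]] := fraisse_seq_back hT (finite_set0 _) mh2.
apply: (dependent_nat_choice (x0 := @Zigzag 0 b (h \o h1) set0)).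
  split => /=; [exact: finite_set0|exact: mor_comp mh|].
  by move=> x [i [p [ia []]]].
exact: zigzag_next.
Qed.

(** * From the zigzag to an intertwining *)

Section Intertwining.
Variables (u : nat -> zigzag).
Hypothesis hu : forall n, zigzag_ok n (u n) /\ zigzag_step n (u n) (u n.+1).

Let a n := zidx (u n).
Let b n := zjdx (u n).

Lemma zidx_homo : {homo a : m n / (m < n)%N}.
Proof.
by apply: homo_ltn => [? ? ?|n]; [exact: ltn_trans|have [_ [g []]] := hu n].
Qed.

Lemma zjdx_homo : {homo b : m n / (m < n)%N}.
Proof.
by apply: homo_ltn => [? ? ?|n]; [exact: ltn_trans|have [_ [g [? []]]] := hu n].
Qed.

Lemma zmap_mor n : mor c (zmap (u n)).
Proof. by have [[]] := hu n. Qed.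

(* The errors of the single steps do not accumulate: the refinement of
   [zset (u j)] is pushed into [zset (u j.+1)]. *)
Lemma zmap_bond j k (aa : (a j <= a k)%N) (bb : (b j <= b k)%N) :
  (j <= k)%N ->
  sim_on (zset (u j)) (zmap (u k) \o bond S aa) (bond T bb \o zmap (u j)).
Proof.
move=> jk; rewrite -(subnK jk) in aa bb *.
move: (k - j)%N => d {jk k} in aa bb *.
elim: d j aa bb => [|d IH] j; rewrite ?add0n ?addSnnS => aa bb.
  have hw x' x : (x' `<< x)%Cu -> zmap (u j) x' <= zmap (u j) x.
    by move=> /way_below_le; have [_ hm _ _] := cu_mor (zmap_mor j); apply: hm.
  by move=> x' x _ _ /hw h /=; rewrite !bond_id.
have [_ [g [ii [jj [E [G [_ [rE _ EF] _ [_ sE] _]]]]]]] := hu j.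
have aa' : (a j.+1 <= a (d + j.+1))%N.
  by apply: (ltnW_homo zidx_homo); apply: leq_addl.
have bb' : (b j.+1 <= b (d + j.+1))%N.
  by apply: (ltnW_homo zjdx_homo); apply: leq_addl.
apply: (sim_on_trans _ _ rE
  (g := bond T bb' \o (zmap (u j.+1) \o bond S (ltnW ii)))).
- by apply: cu_mor; apply: mor_comp (zmap_mor _); apply: bond_mor.
- by apply: cu_mor; apply: mor_comp (zmap_mor _) _; apply: bond_mor.
- have mb := cu_mor (bond_mor S (ltnW ii)).
  apply: sim_on_ext (sim_on_comp_r mb EF (IH j.+1 aa' bb')) => // x /=.
  by rewrite bond_trans.
- have mb := cu_mor (bond_mor T bb').
  apply: sim_on_ext (sim_on_comp_l mb sE) => // x /=.
  by rewrite bond_trans.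
Qed.

Lemma zigzag_intertwining :
  (forall i, way_below_dense (eS i)) -> (forall i, way_below_dense (eT i)) ->
  exists (phi psi : nat -> nat)
         (alpha : forall i : nat, S i -> T (phi i))
         (beta : forall i : nat, T i -> S (psi i)),
    (forall i : nat, mor c (alpha i)) /\
    (forall i : nat, mor c (beta i)) /\
    two_sided_approx_intertwining alpha beta.
Proof.
move=> dS dT.
pose g n : T (b n) -> S (a n.+1) := projT1 (cid (hu n).2).
have hg n : exists (ii : (a n < a n.+1)%N) (jj : (b n < b n.+1)%N) _ _, _ :=
  projT2 (cid (hu n).2).
have a_ge n : (n <= a n)%N.
  by elim: n => // n /leq_ltn_trans; apply; apply: zidx_homo.
have b_ge n : (n <= b n)%N.
  by elim: n => // n /leq_ltn_trans; apply; apply: zjdx_homo.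
have mg n : mor c (g n) by have [? [? [? [? []]]]] := hg n.
(* The shift in [psi] comes from [g i] landing in [S (a i.+1)]. *)
exists b, (a \o succn), (fun i => zmap (u i) \o bond S (a_ge i)),
  (fun i => g i \o bond T (b_ge i)).
split; first by move=> i; apply: mor_comp (zmap_mor i); apply: bond_mor.
split; first by move=> i; apply: mor_comp (mg i); apply: bond_mor.
split; [exact: zjdx_homo|by move=> m n mn; apply: zidx_homo|].
move=> i F G fF fG.
have [N rF] := refines_dense (dS i) fF.
have [M rG] := refines_dense (dT i) fG.
(* From these stages on, the finite sets of the zigzag contain the images of the chosen initial
   segments. *)
exists (maxn i N), (maxn i M); split; [exact: leq_maxl|exact: leq_maxl|].
move=> j j' k k'; rewrite !geq_max => /andP[_ Nj] /andP[_ Mj'].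
move=> ij ij' /= jk jk' ik ik'; split.
- have jk0 : (j <= k)%N := leq_trans (b_ge j) jk.
  have aa : (a j <= a k)%N by apply: (ltnW_homo zidx_homo).
  have bb : (b j <= b k)%N by apply: (ltnW_homo zjdx_homo).
  have ia : (i <= a j)%N := leq_trans ij (a_ge j).
  have ia' : (i <= a k)%N := leq_trans ia aa.
  have [ii [jj [E [G' [_ [_ FE _] _ [sE _] _]]]]] := hg k.
  (* Pivot: [zmap_bond] replaces the passage through [T] by one through [S] up to [a k]; then [g k]
     almost inverts [zmap (u k)]. *)
  apply: sim_on_sym; apply: (sim_on_trans _ _ rF
    (g := (g k \o zmap (u k)) \o bond S ia')).
  + apply: cu_mor; apply: mor_comp (bond_mor S ij) _.
    apply: mor_comp (mor_comp (bond_mor S _) (zmap_mor j)) _.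
    apply: mor_comp (bond_mor T jk) _.
    exact: mor_comp (bond_mor T _) (mg k).
  + by apply: cu_mor; apply: bond_mor.
  + apply: sim_on_sym.
    have [[_ _ abs] _] := hu j.
    have h0 : bond S ia @` (eS i @` `I_N) `<=` zset (u j).
      by apply: subset_trans abs; apply: bases_upto_absorb.
    have := sim_on_comp_r (cu_mor (bond_mor S ia)) h0 (zmap_bond aa bb jk0).
    move=> /(sim_on_comp_l (cu_mor (mg k))).
    by apply: sim_on_ext => x /=; rewrite !bond_trans.
  + have [[_ _ abs] _] := hu k.
    have h0 : bond S ia' @` (eS i @` `I_N) `<=` zset (u k).
      apply: subset_trans abs; apply: bases_upto_absorb.
        exact: leq_trans ij jk0.
      exact: leq_trans Nj jk0.
    have := sim_on_comp_r (cu_mor (bond_mor S ia')) h0 (sim_on_sub FE sE).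
    by apply: sim_on_ext => x //=; rewrite !bond_trans.
- have jk0 : (j'.+1 <= k')%N := leq_trans (a_ge j'.+1) jk'.
  have aa : (a j'.+1 <= a k')%N by apply: (ltnW_homo zidx_homo).
  have bb : (b j'.+1 <= b k')%N by apply: (ltnW_homo zjdx_homo).
  have ib : (i <= b j')%N := leq_trans ij' (b_ge j').
  have [ii [jj [E [G' [_ _ [abs GF] _ sG]]]]] := hg j'.
  have h0 : bond T ib @` (eT i @` `I_M) `<=` G'.
    by apply: subset_trans abs; apply: bases_upto_absorb.
  (* Pivot: [zmap_bond] from stage [j'.+1], pulled back along [g j']; then [zmap (u j'.+1)] almost
     inverts [g j']. *)
  apply: sim_on_sym; apply: (sim_on_trans _ _ rG
    (g := bond T bb \o ((zmap (u j'.+1) \o g j') \o bond T ib))).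
  + apply: cu_mor; apply: mor_comp (bond_mor T ij') _.
    apply: mor_comp (mor_comp (bond_mor T _) (mg j')) _.
    apply: mor_comp (bond_mor S jk') _.
    exact: mor_comp (bond_mor S _) (zmap_mor k').
  + by apply: cu_mor; apply: bond_mor.
  + have := sim_on_comp_r (cu_mor (mg j')) GF (zmap_bond aa bb jk0).
    move=> /(sim_on_comp_r (cu_mor (bond_mor T ib)) h0).
    by apply: sim_on_ext => x /=; rewrite ?bond_trans.
  + have := sim_on_comp_r (cu_mor (bond_mor T ib)) h0 sG.
    move=> /(sim_on_comp_l (cu_mor (bond_mor T bb))).
    have bb0 : (b j' <= b k')%N := leq_trans (ltnW jj) bb.
    by apply: sim_on_ext => x //=; rewrite (bond_trans _ _ bb0) bond_trans.
Qed.

End Intertwining.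
End Uniqueness.

(** * Inductive sequences generated by one-step maps *)

Section Chain.
Variables (X : nat -> cuSemigroupType) (t : forall n, X n -> X n.+1).

Definition cast_term i j (e : i = j) (x : X i) : X j := ecast k (X k) e x.

(* The junk value [0] is only taken when [j < i]. *)
Fixpoint chain i j : X i -> X j :=
  match j with
  | 0%N => if i =P 0%N is ReflectT e then cast_term e else fun=> pom_zero
  | j'.+1 => if i =P j'.+1 is ReflectT e then cast_term e
             else @t j' \o @chain i j'
  end.
Arguments chain : clear implicits.

Lemma chainid i : chain i i = id.
Proof.
have cast_id n (e : n = n) : cast_term e = id.
  by rewrite (eq_irrelevance e (erefl n)).
by case: i => [|i] /=; case: eqP => // e; apply: cast_id.
Qed.

Lemma chainS i j : (i <= j)%N -> chain i j.+1 = @t j \o chain i j.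
Proof.
by move=> ij /=; case: eqP => // e; exfalso; move: ij; rewrite e ltnn.
Qed.

Lemma chain_trans i j k : (i <= j)%N -> (j <= k)%N ->
  chain j k \o chain i j = chain i k.
Proof.
move=> ij /subnK <-; elim: (k - j)%N => [|d IH].
  by rewrite add0n chainid.
rewrite addSn !chainS ?leq_addl //; last exact: leq_trans ij (leq_addl _ _).
by rewrite -IH.
Qed.

Variables (c : subcategory).
Hypothesis oX : forall n, obj c (X n).
Hypothesis mt : forall n, mor c (@t n).

Lemma chain_mor i j : (i <= j)%N -> mor c (chain i j).
Proof.
move=> /subnK <-; elim: (j - i)%N => [|d IH].
  by rewrite add0n chainid; apply: mor_id.
by rewrite addSn chainS ?leq_addl //; apply: mor_comp IH (mt _).
Qed.

Definition chain_seq : ind_seq c.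
Proof.
refine (@IndSeq c X (fun i j _ => chain i j) _ _ _).
- by move=> i j; apply: chain_mor.
- by move=> i _ x; rewrite chainid.
- by move=> i j k ij jk ik x; rewrite chain_trans.
Defined.

End Chain.
Arguments chain {X} t i j _.

(** An enumeration of all morphisms of [s] is filtered by source: entries starting at [A] are
    transported along the equality of sources, all others become the identity. *)
Lemma mor_enumeration (s : subcategory) (A : cuSemigroupType) :
  countable (morphisms s) -> obj s A ->
  exists e : nat -> {T : cuSemigroupType & A -> T},
    (forall m, mor s (projT2 (e m))) /\
    (forall (T : cuSemigroupType) (f : A -> T), mor s f ->
       exists m, e m = existT _ T f).
Proof.
move=> cs oA; have /pfcard_geP[s0|[g]] := cs.
  suff : morphisms s (existT _ A (existT _ A id)) by rewrite s0.
  exact: mor_id.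
pose e m : {T : cuSemigroupType & A -> T} :=
  let: existT B p := g m in
  if pselect (B = A) is left BA then ecast D {T : cuSemigroupType & D -> T} BA p
  else existT _ A id.
exists e; split => [m|T f mf].
  have gm : morphisms s (g m) by apply: (@funS _ _ _ _ g).
  rewrite /e; case: (g m) gm => B p mp.
  case: pselect => [BA|_]; last exact: mor_id.
  by case: A / BA oA @e.
have [m _ gm] := @surj _ _ _ _ g (existT _ A (existT _ T f)) mf.
exists m; rewrite /e gm; case: pselect => // AA.
by rewrite (Prop_irrelevance AA erefl).
Qed.

(** * Existence: absorbing all morphisms of the countable subcategory *)

Section Existence.
Variables c s : subcategory.
Hypothesis nap : NAP c.
Hypothesis sc : subcategory_le s c.
Hypothesis sep : forall (S A : cuSemigroupType) (sigma : S -> A) (F : set S),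
  obj s S -> mor c sigma -> finite_set F ->
  exists (T : cuSemigroupType) (alpha : A -> T) (tau : S -> T),
    [/\ obj s T, mor c alpha, mor s tau & sim_on F (alpha \o sigma) tau].

Variable e : forall A : cuSemigroupType, nat -> {T : cuSemigroupType & A -> T}.
Hypothesis e_mor : forall A, obj s A -> forall m, mor s (projT2 (e A m)).
Hypothesis e_surj : forall A, obj s A ->
  forall (T : cuSemigroupType) (f : A -> T), mor s f ->
  exists m, e A m = existT _ T f.

Variable d : forall A : cuSemigroupType, nat -> A.
Hypothesis d_dense : forall A, obj s A -> way_below_dense (d A).

(* An object together with the bonding maps from all earlier ones; entries of
   [harr] beyond the current stage are identities. *)
Record history := History {
  hobj : cuSemigroupType;
  harr : nat -> {A : cuSemigroupType & A -> hobj} }.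

Definition history_ok n (h : history) :=
  [/\ obj s (hobj h), forall i, mor s (projT2 (harr h i)) &
      forall i, (n <= i)%N -> harr h i = existT _ (hobj h) id].

(** Absorption of [q]: some [gamma] leads from its target to [X] and recovers [sigma] up to the
    first [n] points of [d A]. *)
Definition factors n (A X : cuSemigroupType) (sigma : A -> X)
    (q : {T : cuSemigroupType & A -> T}) :=
  exists gamma : projT1 q -> X,
    mor c gamma /\ sim_on (d A @` `I_n) (gamma \o projT2 q) sigma.

Definition solves n m (X X' : cuSemigroupType) (t : X -> X')
    (p : {A : cuSemigroupType & A -> X}) :=
  factors n (t \o projT2 p) (e (projT1 p) m).

(* The pair of the i-th object and its m-th outgoing morphism is treated at
   every stage [2 ^ i * 3 ^ m * 5 ^ L], hence on arbitrarily large finite sets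
   and never before the i-th object is available. *)
Definition history_bond n (h h' : history) (t : hobj h -> hobj h') :=
  [/\ mor s t,
      forall i, (i <= n)%N -> harr h' i =
        existT _ (projT1 (harr h i)) (t \o projT2 (harr h i)) &
      solves n (logn 3 n) t (harr h (logn 2 n))].

(** (NAP) gives [b2 \o f] close to [b1 \o sigma], and (SEP) applied to [b1] gives [al \o b1] close
    to [t] on the image of [E]; hence [gamma] is [al \o b2]. *)
Lemma history_next n h : history_ok n h ->
  exists h', history_ok n.+1 h' /\
    exists t : hobj h -> hobj h', history_bond n t.
Proof.
case: h => X H [/= oX mH _].
have := mH (logn 2 n); case Hn : (H (logn 2 n)) => [A sigma] /= msigma.
have [oA _ _] := mor_cu msigma.
have := e_mor oA (logn 3 n); case en : (e A (logn 3 n)) => [T f] /= mf.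
have fF : finite_set (d A @` `I_n) by exact: finite_image.
have [E [fE FE rE]] := refines_exists fF.
have [C [b1 [b2 [_ mb1 mb2 b12]]]] :=
  nap (sc.2 _ _ _ msigma) (sc.2 _ _ _ mf) fE.
have [X' [al [t [oX' mal mt alt]]]] :=
  sep oX mb1 (finite_image sigma fE).
pose into (B : cuSemigroupType) (g : B -> X') :=
  existT (fun B : cuSemigroupType => B -> X') B g.
(* The entry [n] was the identity, so it becomes [t]; the entry [n.+1] is the identity of the new
   object. *)
exists (@History X' (fun i =>
  if (i <= n)%N then into _ (t \o projT2 (H i)) else into _ id)); split.
  split => //= i; last by rewrite ltnNge => /negbTE->.
  by case: ifP => _ /=; [exact: mor_comp (mH i) mt|exact: mor_id].
exists t; split => //= [i ->//|]; rewrite Hn /solves /= en.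
exists (al \o b2); split; first exact: mor_comp mal.
apply: (sim_on_trans _ _ rE (g := (al \o b1) \o sigma)).
- by apply: (@cu_mor c); apply: mor_comp (mor_comp mb2 mal); apply: sc.2.
- by apply: (@cu_mor s); apply: mor_comp mt.
- by apply: sim_on_sym; apply: (sim_on_comp_l (cu_mor mal) b12).
- by apply: sim_on_comp_r alt => //; apply: cu_mor msigma.
Qed.

(** A [c]-morphism [al] out of the [i]-th term is first pushed by (SEP) to a morphism [f] of [s];
    [f] is enumerated, hence absorbed at some stage, and composing gives the required map back. *)
Lemma fraisse_seq_exists : (forall A, obj s A -> countably_based A) ->
  (exists A, obj s A) -> exists S : ind_seq c, fraisse_seq S.
Proof.
move=> cb [A0 oA0].
have [|u hu] := dependent_nat_choice
    (x0 := @History A0 (fun=> existT _ A0 id)) _ history_next.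
  by split => //= _; apply: mor_id.
pose X n := hobj (u n).
have [t ht] : exists t : forall n, X n -> X n.+1,
    forall n, history_bond n (@t n).
  by exists (fun n => projT1 (cid (hu n).2)) => n; case: (cid (hu n).2).
have oX n : obj s (X n) by have [[]] := hu n.
have mt n : mor c (@t n) by have [/sc.2] := ht n.
(* The stored arrows are the bonding maps of the sequence. *)
have harrE i j : (i <= j)%N -> harr (u j) i = existT _ (X i) (chain t i j).
  move=> /subnK <-; elim: (j - i)%N => [|k IH].
    by rewrite add0n chainid; have [[_ _ ->]] := hu i.
  have [_ hS _] := ht (k + i)%N.
  by rewrite addSn hS ?leq_addl // IH chainS ?leq_addl.
exists (chain_seq (fun n => sc.1 _ (oX n)) mt); split => [i|i F C al fF mal].
  by apply: cb; apply: oX.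
have [L rF] := refines_dense (d_dense (oX i)) fF.
have [T [al' [f [oT mal' mf alf]]]] :=
  sep (oX i) mal (finite_image (d (X i)) (finite_II L)).
have [m em] := e_surj (oX i) mf.
pose n := (2 ^ i * 3 ^ m * 5 ^ L)%N.
have n_gt0 : (0 < n)%N by rewrite !muln_gt0 !expn_gt0.
have i_n : (i <= n)%N.
  rewrite (leq_trans (ltnW (ltn_expl i (isT : 1 < 2)%N))) //.
  by apply: dvdn_leq => //; rewrite /n -mulnA dvdn_mulr.
have L_n : (L <= n)%N.
  rewrite (leq_trans (ltnW (ltn_expl L (isT : 1 < 5)%N))) //.
  by apply: dvdn_leq => //; rewrite /n dvdn_mull.
have log2 : logn 2 n = i.
  rewrite /n !lognM ?muln_gt0 ?expn_gt0 // !lognX !logn_prime //.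
  by rewrite !muln0 muln1 !addn0.
have log3 : logn 3 n = m.
  rewrite /n !lognM ?muln_gt0 ?expn_gt0 // !lognX !logn_prime //.
  by rewrite !muln0 muln1 !addn0.
have [_ _] := ht n; rewrite log2 log3 harrE // /solves /= em.
move=> [gamma [mgamma gf]]; rewrite /= in gamma mgamma gf.
exists n.+1, (leqW i_n), (gamma \o al'); split; first exact: mor_comp mgamma.
have gf' : sim_on (d (X i) @` `I_L) (gamma \o f) (chain t i n.+1).
  rewrite chainS //; apply: sim_on_sub gf => _ [p pL <-].
  by exists p => //; apply: leq_trans pL L_n.
apply: (sim_on_trans _ _ rF (g := gamma \o f) _ gf').
- by apply: (@cu_mor c); apply: mor_comp (mor_comp mal' mgamma).
- apply: (@cu_mor c); apply: chain_mor => //; last exact: leqW.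
  by move=> k; apply: sc.1.
- exact: (sim_on_comp_l (cu_mor mgamma) alf).
Qed.

End Existence.

(** * Deriving existence and uniqueness from (JEP), (NAP) and (SEP) *)

Theorem theorem3p21 (c : subcategory)
    (c_nonempty : exists A : cuSemigroupType, obj c A)
    (c_fraisse : fraisse_category c) :
  (exists S : ind_seq c, fraisse_seq S) /\
  (forall S T : ind_seq c, fraisse_seq S -> fraisse_seq T ->
     exists (phi psi : nat -> nat)
            (alpha : forall i : nat, S i -> T (phi i))
            (beta : forall i : nat, T i -> S (psi i)),
       (forall i : nat, mor c (alpha i)) /\
       (forall i : nat, mor c (beta i)) /\
       two_sided_approx_intertwining alpha beta).
Proof.
have [jep nap [s [sc cb cs dom sep]]] := c_fraisse; split; last first.
  move=> S T hS hT.
  have dS i := cid (countably_based_dense (hS.1 i)).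
  have dT i := cid (countably_based_dense (hT.1 i)).
  have [u hu] := @zigzag_exists c S T (fun i => projT1 (dS i))
    (fun i => projT1 (dT i)) hS hT jep.
  by apply: (zigzag_intertwining hu) => i; [case: (dS i)|case: (dT i)].
(* Default values outside [s] make the choice of enumerations, and then of dense sequences, total in
   [A]. *)
have he (A : cuSemigroupType) :
    exists e : nat -> {T : cuSemigroupType & A -> T}, obj s A ->
    (forall m, mor s (projT2 (e m))) /\
    (forall (T : cuSemigroupType) (f : A -> T), mor s f ->
       exists m, e m = existT _ T f).
  have [oA|noA] := pselect (obj s A); last by exists (fun=> existT _ A id).
  by have [e he] := mor_enumeration cs oA; exists e.
have hd (A : cuSemigroupType) :
    exists d : nat -> A, obj s A -> way_below_dense d.
  have [oA|noA] := pselect (obj s A); last by exists (fun=> pom_zero).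
  by have [d hd] := countably_based_dense (cb A oA); exists d.
apply: (@fraisse_seq_exists c s nap sc sep
  (fun A => projT1 (cid (he A))) _ _ (fun A => projT1 (cid (hd A)))) => //.
- by move=> A oA; case: (cid (he A)) => e /= /(_ oA)[].
- by move=> A oA; case: (cid (he A)) => e /= /(_ oA)[].
- by move=> A oA; case: (cid (hd A)) => d /= /(_ oA).
(* A first term for the sequence: (SEP) maps an object of [c] to one of [s]. *)
- have [A oA] := c_nonempty; have [S [f [oS _]]] := dom A oA.
  by exists S.
Qed.
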